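(* Let $\mathbb{K}$ be a field of characteristic zero and let $\varphi=(\varphi(x_1),\ldots,\varphi(x_N))$ be a $\mathbb{K}$-algebra automorphism of the polynomial algebra $\mathbb{K}[x_1,\ldots,x_N]$ whose Jacobian $\mathrm{J}(\varphi)=\det\left[\frac{\partial \varphi(x_i)}{\partial x_j}\right]$ is equal to $1$. Then there exists a sequence $\{\psi_k\}_{k\ge 1}$ of tame automorphisms of $\mathbb{K}[x_1,\ldots,x_N]$ which converges to $\varphi$ in the formal power series topology.
   Context: An endomorphism $\varphi$ of $\mathbb{K}[x_1,\ldots,x_N]$ (unital, $\mathbb{K}$-linear) is identified with the tuple $(\varphi(x_1),\ldots,\varphi(x_N))$ of images of the generators. Elementary and tame automorphisms: an automorphism of $\mathbb{K}[x_1,\ldots,x_N]$ is elementary if, for some index $k$, it has the form $(x_1,\ldots,x_{k-1},\,a x_k+f(x_1,\ldots,x_{k-1},x_{k+1},\ldots,x_N),\,x_{k+1},\ldots,x_N)$ with $a\in\mathbb{K}^{\times}$ and $f$ a polynomial not involving $x_k$. The group of tame automorphisms is the subgroup of the automorphism group generated by all elementary automorphisms. Height: the height $\mathrm{ht}(f)$ of a polynomial $f$ is the least $k$ such that the homogeneous component of $f$ of total degree $k$ is nonzero (each $\deg x_i=1$), and $\mathrm{ht}(0)=\infty$. For a tuple of polynomials the height is the minimum of the heights of its entries. Formal power series topology: the topology on the set of endomorphisms given by the metric $d(\varphi,\psi)=\exp(-\mathrm{ht}(\varphi-\psi))$, where $\varphi-\psi$ is the tuple of entrywise differences. Thus $\psi_k$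 converges to $\varphi$ iff $\mathrm{ht}(\psi_k-\varphi)\to\infty$. *)

(* Defs.v *)
From Stdlib Require Import Reals.
From HB Require Import structures.
From mathcomp Require Import all_boot all_order all_algebra.
From mathcomp Require Export mpoly.

Set Implicit Arguments.
Unset Strict Implicit.
Unset Printing Implicit Defensive.

Import GRing.Theory.
Local Open Scope ring_scope.
Delimit Scope R_scope with Re.

Notation endo K N := {lrmorphism {mpoly K[N]} -> {mpoly K[N]}}.

Section Tame.
Variables (K : fieldType) (N : nat).
Implicit Types (phi psi chi : endo K N) (p f : {mpoly K[N]}).

Definition jacobian phi : {mpoly K[N]} :=
  \det (\matrix_(i < N, j < N) mderiv j (phi 'X_i)).

Definition free_of (k : 'I_N) f : Prop := forall m, m \in msupp f -> m k = 0%N.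

Definition elementary phi : Prop :=
  bijective phi /\
  exists (k : 'I_N) (a : K) (f : {mpoly K[N]}),
    [/\ a != 0, free_of k f, phi 'X_k = a *: 'X_k + f &
        forall i, i != k -> phi 'X_i = 'X_i].

(* The subgroup generated by the elementary automorphisms; the hypotheses are
   pointwise because lrmorphisms are records, for which extensional equality
   is not Leibniz equality without further axioms. *)
Inductive tame : endo K N -> Prop :=
| tame_elementary phi : elementary phi -> tame phi
| tame_id phi : (forall p, phi p = p) -> tame phi
| tame_comp phi psi chi : tame phi -> tame psi -> chi =1 phi \o psi -> tame chi
| tame_inv phi psi : tame phi -> cancel phi psi -> cancel psi phi -> tame psi.

(* Heights live in [option nat], with [None] standing for infinity. The search
   stops at [msize p], one more than the total degree of p. *)
Definition ht p : option nat :=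
  ohead [seq k <- iota 0 (msize p) | pihomog mdeg k p != 0].

Lemma ht_Some_min p k : ht p = Some k ->
  pihomog mdeg k p != 0 /\ forall j, (j < k)%N -> pihomog mdeg j p = 0.
Proof.
rewrite /ht; set P := fun k => _; move: (msize p) => n.
suff H m : ohead (filter P (iota m n)) = Some k ->
    P k /\ forall j, (m <= j < k)%N -> pihomog mdeg j p = 0.
  by move/H=> [Pk min]; split=> // j ltjk; apply: min.
elim: n m => [//|n IHn] m /=; case: ifP => [Pm [<-]|/negbFE/eqP Pm /IHn[Pk min]].
  by split=> // j /andP[le_mj]; rewrite ltnNge le_mj.
split=> // j /andP[]; rewrite leq_eqVlt => /predU1P[<- //|lt_mj lt_jk].
by apply: min; rewrite lt_mj.
Qed.

Lemma ht_None p : ht p = None <-> p = 0.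
Proof.
split=> [h|->]; last by rewrite /ht msize0.
rewrite (@pihomog_partitionE _ _ mdeg (msize p) p) // big1 // => i _.
apply/eqP/negPn/negP=> nz.
have: val i \in [seq k <- iota 0 (msize p) | pihomog mdeg k p != 0].
  by rewrite mem_filter nz mem_iota /=.
by move: h; rewrite /ht; case: [seq _ <- _ | _].
Qed.

Lemma ht_Some p k : ht p = Some k <->
  pihomog mdeg k p != 0 /\ forall j, (j < k)%N -> pihomog mdeg j p = 0.
Proof.
split=> [|[nzk mink]]; first exact: ht_Some_min.
case E: (ht p) => [l|]; last by move/ht_None: E nzk => ->; rewrite pihomog0 eqxx.
have [nzl minl] := ht_Some_min E.
case: (ltngtP k l) => [/minl|/mink|->//] z; first by rewrite z eqxx in nzk.
by rewrite z eqxx in nzl.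
Qed.

(* [oAC minnA minnC] is [minn] extended to [option nat] with [None] neutral. *)
Definition tuple_ht (u : 'I_N -> {mpoly K[N]}) : option nat :=
  \big[oAC minnA minnC/None]_(i < N) ht (u i).

Definition dist phi psi : R :=
  if tuple_ht (fun i => phi 'X_i - psi 'X_i) is Some k
  then exp (- INR k)%Re else 0%Re.

Definition converges (psi : nat -> endo K N) phi : Prop :=
  Un_cv (fun k => dist (psi k) phi) 0%Re.

End Tame.

(* Main.v *)
(* Following Anick. After translating so that phi fixes the origin and composing
   with a linear tame automorphism, phi is the identity up to order 2. If it is
   the identity up to order k >= 2, then constancy of the Jacobian makes the
   degree k part h of phi - id divergence-free. Divergence-free fields of degree
   k are spanned by fields f d_i with f free of x_i and by the fields
     x^w ((w_j + 1) x_i d_i - (w_i + 1) x_j d_j),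
   which in characteristic 0 are combinations of shears along the linear forms
   x_i + t x_j, by inverting a Vandermonde matrix. Every shear is a linear
   conjugate of an elementary automorphism, so h is removed, one degree at a
   time, by composing with tame automorphisms. *)
From Stdlib Require Import Reals Lra IndefiniteDescription.
Require Import Defs.
From mathcomp Require Import all_boot all_order all_algebra fingroup perm.
From mathcomp Require Import ring zify.

Set Implicit Arguments.
Unset Strict Implicit.
Unset Printing Implicit Defensive.

Import GRing.Theory.
Local Open Scope ring_scope.

(** * Order of vanishing at the origin, and how endomorphisms act on it *)

Section Order.
Variables (K : fieldType) (N : nat).
Implicit Types (p q : {mpoly K[N]}) (m : 'X_{1..N}) (phi psi eps : endo K N).

(** Height at least [d], phrased on coefficients so that [0] needs no infinite value. *)
Definition ord_ge d p : Prop := forall m, (mdeg m < d)%N -> p@_m = 0.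

Lemma ord_ge_zero d : ord_ge d (0 : {mpoly K[N]}).
Proof. by move=> m _; rewrite mcoeff0. Qed.

Lemma ord_geW d e p : (e <= d)%N -> ord_ge d p -> ord_ge e p.
Proof. by move=> led h m lt; apply: h; apply: leq_trans led. Qed.

Lemma ord_geD d p q : ord_ge d p -> ord_ge d q -> ord_ge d (p + q).
Proof. by move=> hp hq m lt; rewrite mcoeffD hp ?hq ?addr0. Qed.

Lemma ord_geN d p : ord_ge d p -> ord_ge d (- p).
Proof. by move=> hp m lt; rewrite mcoeffN hp ?oppr0. Qed.

Lemma ord_geB d p q : ord_ge d p -> ord_ge d q -> ord_ge d (p - q).
Proof. by move=> hp hq; apply: ord_geD => //; apply: ord_geN. Qed.

Lemma ord_geZ d c p : ord_ge d p -> ord_ge d (c *: p).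
Proof. by move=> hp m lt; rewrite mcoeffZ hp ?mulr0. Qed.

Lemma ord_ge_sum d (I : Type) (s : seq I) (P : pred I) (F : I -> {mpoly K[N]}) :
  (forall i, P i -> ord_ge d (F i)) -> ord_ge d (\sum_(i <- s | P i) F i).
Proof.
by move=> h; apply: big_ind => //; [apply: ord_ge_zero | apply: ord_geD].
Qed.

Lemma ord_geM d e p q : ord_ge d p -> ord_ge e q -> ord_ge (d + e) (p * q).
Proof.
move=> hp hq m lt; rewrite mcoeffM big1 // => -[k1 k2] /= /eqP /(congr1 (@mdeg N)).
rewrite mdegD => def_m.
have [lt1|le1] := ltnP (mdeg k1) d; first by rewrite hp ?mul0r.
by rewrite hq ?mulr0 //; lia.
Qed.

Lemma ord_geMl d p q : ord_ge d q -> ord_ge d (p * q).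
Proof. exact: (@ord_geM 0). Qed.

Lemma ord_geMr d p q : ord_ge d p -> ord_ge d (p * q).
Proof. by rewrite mulrC; apply: ord_geMl. Qed.

Lemma ord_geX d m : (d <= mdeg m)%N -> ord_ge d ('X_[m] : {mpoly K[N]}).
Proof.
by move=> le m' lt; rewrite mcoeffX; case: eqP => // e; move: lt; rewrite -e ltnNge le.
Qed.

Lemma ord_ge_trans d q p r : ord_ge d (p - q) -> ord_ge d (q - r) -> ord_ge d (p - r).
Proof. by move=> h1 h2; have := ord_geD h1 h2; rewrite addrA subrK. Qed.

Lemma ord_ge_exp p n d : ord_ge d p -> ord_ge (n * d) (p ^+ n).
Proof.
by move=> hp; elim: n => // n IHn; rewrite mulSn exprS; apply: ord_geM.
Qed.

Lemma mpoly_gen_ind (P : {mpoly K[N]} -> Prop) :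
  (forall c, P c%:MP) -> (forall i, P 'X_i) ->
  (forall p q, P p -> P q -> P (p + q)) ->
  (forall p q, P p -> P q -> P (p * q)) -> forall p, P p.
Proof.
move=> PC PX PD PM p; rewrite [p]mpolyE.
apply: big_ind => [||m _]; [by rewrite -mpolyC0 | by [] |].
rewrite -mul_mpolyC; apply: (PM) => //; rewrite mpolyXE_id.
apply: big_ind => [||i _]; [by rewrite -mpolyC1 | exact: PM |].
by elim: (m i) => [|n IHn]; [rewrite expr0 -mpolyC1 | rewrite exprS; apply: (PM)].
Qed.

Lemma endoC phi c : phi c%:MP = c%:MP.
Proof. by rewrite -alg_mpolyC linearZ /= rmorph1. Qed.

Lemma endo_ext phi psi : (forall i, phi 'X_i = psi 'X_i) -> phi =1 psi.
Proof.
move=> h; apply: mpoly_gen_ind => [c|//|p q|p q]; first by rewrite !endoC.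
  by rewrite !rmorphD /= => -> ->.
by rewrite !rmorphM /= => -> ->.
Qed.

(** The opaque proof hides [comp_mpoly]: later arguments see only the images of the generators. *)
Lemma subst_endo_subproof (g : 'I_N -> {mpoly K[N]}) :
  {phi : endo K N | forall i, phi 'X_i = g i}.
Proof.
exists (comp_mpoly [tuple g i | i < N] : endo K N) => i.
by rewrite /= comp_mpolyXU -tnth_nth tnth_mktuple.
Qed.

Definition subst_endo g : endo K N := sval (subst_endo_subproof g).

Lemma subst_endoX g i : subst_endo g 'X_i = g i.
Proof. exact: svalP (subst_endo_subproof g) i. Qed.

(** The closed ball of radius exp(-d) for [dist], free of real numbers. *)
Definition agree d phi psi : Prop := forall i, ord_ge d (phi 'X_i - psi 'X_i).

Lemma agreeP d phi psi : agree d phi psi -> forall p, ord_ge d (phi p - psi p).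
Proof.
move=> h; apply: mpoly_gen_ind => [c|//|p q hp hq|p q hp hq].
- by rewrite !endoC subrr; apply: ord_ge_zero.
- by rewrite !rmorphD /= opprD addrACA; apply: ord_geD.
have -> : phi (p * q) - psi (p * q) =
    (phi p - psi p) * phi q + psi p * (phi q - psi q) by rewrite !rmorphM /=; ring.
by apply: ord_geD; [apply: ord_geMr | apply: ord_geMl].
Qed.

Definition centered phi : Prop := forall i, ord_ge 1 (phi 'X_i).

(** A monomial of degree [e] is sent to a product of [e] factors, each without constant term. *)
Lemma centered_ord_ge phi d p : centered phi -> ord_ge d p -> ord_ge d (phi p).
Proof.
move=> cphi hp; rewrite [p]mpolyE rmorph_sum /=.
apply: ord_ge_sum => m _; rewrite linearZ /=.
have [lt|le] := ltnP (mdeg m) d; first by rewrite hp // scale0r; apply: ord_ge_zero.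
apply/ord_geZ/(ord_geW le); rewrite mdegE mpolyXE_id rmorph_prod /=.
apply: (big_ind2 (fun q e => ord_ge e q)) => // [q1 e1 q2 e2|i _]; first exact: ord_geM.
by have := ord_ge_exp (n := m i) (cphi i); rewrite muln1 rmorphXn.
Qed.

Definition unipotent phi : Prop := agree 2 phi idfun.

Lemma unipotent_centered phi : unipotent phi -> centered phi.
Proof.
move=> h i; rewrite -[phi _](subrK 'X_i).
by apply: ord_geD; [apply: ord_geW (h i) | apply: ord_geX; rewrite mdeg1].
Qed.

(** This gain of one order is what lets a correction of leading degree [d] pass through a unipotent
    map at the cost of higher terms only. *)
Lemma unipotent_ord_ge phi d p :
  unipotent phi -> ord_ge d p -> ord_ge d.+1 (phi p - p).
Proof.
move=> uphi hp; rewrite [p in phi p - p]mpolyE rmorph_sum /= -sumrB.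
apply: ord_ge_sum => m _; rewrite linearZ /= -scalerBr.
have [lt|le] := ltnP (mdeg m) d; first by rewrite hp // scale0r; apply: ord_ge_zero.
apply: ord_geZ; have {le} : (d.+1 <= (mdeg m).+1)%N by []. move=> /ord_geW; apply.
rewrite mdegE mpolyXE_id rmorph_prod /=.
(* [rel] is stable under products with orders adding up, by telescoping the difference of products;
   a monomial thus reduces to its generators. *)
pose rel e p q := [/\ ord_ge e p, ord_ge e q & ord_ge e.+1 (p - q)].
have relM e1 p1 q1 e2 p2 q2 : rel e1 p1 q1 -> rel e2 p2 q2 -> rel (e1 + e2)%N (p1 * p2) (q1 * q2).
  move=> [hp1 hq1 h1] [hp2 hq2 h2]; split; try exact: ord_geM.
  have -> : p1 * p2 - q1 * q2 = (p1 - q1) * p2 + q1 * (p2 - q2) by ring.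
  by apply: ord_geD; [rewrite -addSn | rewrite -addnS]; apply: ord_geM.
suff [] : rel (\sum_i m i)%N (\prod_i phi ('X_i ^+ m i)) (\prod_i 'X_i ^+ m i) by [].
have rel0 : rel 0%N 1 1 by split=> //; rewrite subrr; apply: ord_ge_zero.
apply: (big_ind3 rel) => // i _; elim: (m i) => [|n IHn]; first by rewrite expr0 rmorph1.
rewrite !exprS rmorphM -add1n; apply: (relM) => //; split; last exact: uphi.
  exact: unipotent_centered.
by apply: ord_geX; rewrite mdeg1.
Qed.

Lemma mderivXU i j : mderiv j ('X_i : {mpoly K[N]}) = (i == j)%:R.
Proof.
rewrite mderivX mnm1E; case: eqP => [->|_]; last by rewrite scale0r.
by rewrite -[X in 'X_[X - _]](add0m U_(j)%MM) addmK mpolyX0 scale1r.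
Qed.

(** The chain rule: both sides behave alike under sums and, by Leibniz, under products, so the
    generators decide. *)
Lemma mderiv_endo phi p j :
  mderiv j (phi p) = \sum_l phi (mderiv l p) * mderiv j (phi 'X_l).
Proof.
move: p; apply: mpoly_gen_ind => [c|i|p q hp hq|p q hp hq].
- by rewrite endoC mderivC big1 // => l _; rewrite mderivC rmorph0 mul0r.
- rewrite (bigD1 i) //= big1 => [|l neq_li].
    by rewrite mderivXU eqxx rmorph1 mul1r addr0.
  by rewrite mderivXU eq_sym (negPf neq_li) rmorph0 mul0r.
- rewrite rmorphD /= !mderivD hp hq -big_split /=; apply: eq_bigr => l _.
  by rewrite mderivD rmorphD mulrDl.
rewrite rmorphM /= mderivM hp hq mulr_suml mulr_sumr -big_split /=.
apply: eq_bigr => l _; by rewrite mderivM rmorphD !rmorphM /= mulrDl mulrA [in LHS]mulrAC.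
Qed.

Lemma jacobian_comp phi psi :
  jacobian (phi \o psi : endo K N) = phi (jacobian psi) * jacobian phi.
Proof.
rewrite /jacobian -det_map_mx -det_mulmx; congr (\det _).
by apply/matrixP=> i j; rewrite !mxE /= mderiv_endo; apply: eq_bigr => l _; rewrite !mxE.
Qed.

End Order.

(** * Reducing an invertible matrix to the identity by single-row matrices *)

Section RowReplacement.

Lemma det_row_replaced (R : comNzRingType) n (M : 'M[R]_n) k :
  (forall i j, i != k -> M i j = (i == j)%:R) -> \det M = M k k.
Proof.
move=> hM; rewrite (expand_det_col M k) (bigD1 k) //= big1 => [|i neq_ik]; last first.
  by rewrite hM // (negPf neq_ik) mul0r.
rewrite addr0 /cofactor addnn -mul2n exprM sqrrN expr1n expr1n mul1r.
rewrite [row' _ _](_ : _ = 1%:M) ?det1 ?mulr1 //.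
by apply/matrixP=> i j; rewrite !mxE hM ?(inj_eq lift_inj) // eq_sym neq_lift.
Qed.

Variables (F : fieldType) (n : nat).

(** The shape of the linear part of an elementary automorphism of index [k]. *)
Definition row_replaced (k : 'I_n) (v : 'I_n -> F) : 'M[F]_n :=
  \matrix_(i, j) if i == k then v j else (i == j)%:R.

Lemma mul_row_replaced (A : 'M[F]_n) k v i j :
  (A *m row_replaced k v) i j = A i j + A i k * (v j - (k == j)%:R).
Proof.
rewrite mxE (bigD1 k) //= mxE eqxx.
under eq_bigr => l neq_lk do rewrite mxE (negPf neq_lk).
have Aij : \sum_l A i l * (l == j)%:R = A i j.
  by rewrite (bigD1 j) //= eqxx mulr1 big1 ?addr0 // => l /negPf ->; rewrite mulr0.
by rewrite -Aij [in RHS](bigD1 k) //=; ring.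
Qed.

Lemma row_replaced_unit k v : v k != 0 -> row_replaced k v \in unitmx.
Proof.
move=> vk; rewrite unitmxE (@det_row_replaced _ _ _ k) => [|i j /negPf neq_ik].
  by rewrite mxE eqxx unitfE.
by rewrite mxE neq_ik.
Qed.

(** Column reduction by right multiplication: the rows are turned into unit rows from the top down,
    and [d] counts those still to be treated. *)
Lemma unitmx_row_replaced_ind (Q : 'M[F]_n -> Prop) :
    Q 1%:M ->
    (forall A k v, v k != 0 -> Q (A *m row_replaced k v) -> Q A) ->
  forall A, A \in unitmx -> Q A.
Proof.
move=> Q1 Qmul A uA.
suff H d B : B \in unitmx -> (d <= n)%N ->
    (forall i j : 'I_n, (i < n - d)%N -> B i j = (i == j)%:R) -> Q B.
  by apply: (H n A uA) => // i j; rewrite subnn.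
elim: d => [|d IHd] in B * => uB le_dn hB.
  by rewrite [B](_ : _ = 1%:M) //; apply/matrixP=> i j; rewrite hB ?mxE ?subn0.
have lt_k : (n - d.+1 < n)%N by lia.
pose k := Ordinal lt_k.
have hBk (i : 'I_n) : (i < k)%N -> B i k = 0.
  by move=> lt_ik; rewrite hB // -val_eqE /= ltn_eqF.
have step C : C \in unitmx -> C k k != 0 ->
    (forall i j : 'I_n, (i < k)%N -> C i j = (i == j)%:R) -> Q C.
  (* This [v] solves for row [k] of the product to be the unit row; in particular [v k] is the
     inverse of the pivot. Rows above have a zero in column [k] and do not change. *)
  move=> uC Ckk hC; pose v j := (k == j)%:R + ((k == j)%:R - C k j) / C k k.
  have vk : v k != 0.
    by rewrite /v eqxx mulrBl divff // addrC subrK mul1r invr_eq0.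
  apply: (Qmul _ k v vk); apply: IHd; [|lia|].
    by rewrite unitmx_mul uC row_replaced_unit.
  move=> i j lt_i; rewrite mul_row_replaced.
  have [->|neq_ik] := eqVneq i k.
    by rewrite /v addrAC subrr add0r mulrCA divff // mulr1 addrC subrK.
  have lt_ik : (i < k)%N by move: neq_ik; rewrite -val_eqE /=; lia.
  by rewrite !hC // (negPf neq_ik) mul0r addr0.
have [Bkk|] := eqVneq (B k k) 0; last by move=> Bkk; apply: step.
(* With a zero pivot, a nonzero entry to its right must supply a new one. *)
have /existsP[j /andP[lt_kj Bkj]] : [exists j : 'I_n, (k < j)%N && (B k j != 0)].
  apply: contraT; rewrite negb_exists => /forallP hk.
  have Bk0 (i : 'I_n) : (k <= i)%N -> B k i = 0.
    rewrite leq_eqVlt => /predU1P[/val_inj <- //|lt_ki].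
    by move: (hk i); rewrite lt_ki negbK => /eqP.
  (* Otherwise row k of B is a combination of the unit rows above it, hence fixed by
     B, so it equals e_k and B k k = 1. *)
  have rowk : row k B *m B = row k B.
    apply/rowP=> j; rewrite !mxE (bigD1 j) //= big1 => [|i neq_ij]; rewrite !mxE.
      have [lt_jk|le_kj] := ltnP j k; first by rewrite (hB j) // eqxx mulr1 addr0.
      by rewrite Bk0 // mul0r addr0.
    have [lt_ik|le_ki] := ltnP i k; first by rewrite (hB i) // (negPf neq_ij) mulr0.
    by rewrite Bk0 // mul0r.
  have /rowP/(_ k) : row k B = delta_mx 0 k.
    apply: (can_inj (mulmxK uB)); rewrite rowk; apply/rowP=> j.
    rewrite !mxE (bigD1 k) //= big1 => [|i neq_ik]; rewrite !mxE ?eqxx ?mul1r ?addr0 //.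
    by rewrite (negPf neq_ik) mul0r.
  by rewrite !mxE Bkk !eqxx => /eqP; rewrite eq_sym oner_eq0.
have neq_jk : (j == k) = false by apply/negP=> /eqP e; rewrite e ltnn in lt_kj.
(* Right multiplication by this matrix adds column [j] to column [k], so the new pivot is
   [B k j]. *)
pose v l : F := (l == j)%:R + (l == k)%:R.
have vj : v j != 0 by rewrite /v eqxx neq_jk addr0 oner_eq0.
apply: (Qmul _ j v vj); apply: step.
- by rewrite unitmx_mul uB row_replaced_unit.
- by rewrite mul_row_replaced Bkk /v [k == j]eq_sym neq_jk eqxx !add0r subr0 mulr1.
move=> i l lt_ik; rewrite mul_row_replaced (hB i j) // [i == j](_ : _ = false).
  by rewrite mul0r addr0 hB.
by apply/negP=> /eqP e; move: lt_kj; rewrite -e ltnNge ltnW.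
Qed.

End RowReplacement.

(** * Tame automorphisms with inverses, and normalization of the affine part *)

Section TameAuto.
Variables (K : fieldType) (N : nat).
Implicit Types (f p q : {mpoly K[N]}) (m : 'X_{1..N}) (phi psi eps : endo K N).

(** A nonzero constant instead of 1: elementary factors scale the Jacobian by [a], and this class is
    closed under composition. *)
Definition const_jacobian phi : Prop := exists2 c, c != 0 & jacobian phi = c%:MP.

Lemma const_jacobian_comp phi psi :
  const_jacobian phi -> const_jacobian psi -> const_jacobian (phi \o psi : endo K N).
Proof.
move=> [c nzc hc] [d nzd hd]; exists (d * c); first by rewrite mulf_neq0.
by rewrite jacobian_comp hc hd endoC mpolyCM.
Qed.

(* The inverse is required as an endomorphism: [bijective] only provides a bare
   function. *)
Definition tame_auto phi : Prop :=
  [/\ tame phi, const_jacobian phi &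
      exists2 psi : endo K N, cancel phi psi & cancel psi phi].

Lemma tame_auto_comp phi psi : tame_auto phi -> tame_auto psi -> tame_auto (phi \o psi : endo K N).
Proof.
move=> [tphi jphi [phi' phiK phi'K]] [tpsi jpsi [psi' psiK psi'K]].
split; [exact: (tame_comp tphi tpsi) | exact: const_jacobian_comp |].
by exists (psi' \o phi' : endo K N); apply: can_comp.
Qed.

Lemma tame_auto_id : tame_auto (idfun : endo K N).
Proof.
split; [exact: tame_id | | by exists (idfun : endo K N)].
exists 1; rewrite ?oner_eq0 // /jacobian mpolyC1 -(det1 _ N); congr (\det _).
by apply/matrixP=> i j; rewrite !mxE mderivXU.
Qed.

Definition elem k a f : endo K N :=
  subst_endo (fun i => if i == k then a *: 'X_k + f else 'X_i).

Lemma elemE k a f : elem k a f 'X_k = a *: 'X_k + f.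
Proof. by rewrite subst_endoX eqxx. Qed.

Lemma elem_id k a f i : i != k -> elem k a f 'X_i = 'X_i.
Proof. by rewrite subst_endoX => /negPf ->. Qed.

Lemma elem_free k a f g : free_of k g -> elem k a f g = g.
Proof.
move=> hg; rewrite [g]mpolyE rmorph_sum /= big_seq [RHS]big_seq.
apply: eq_bigr => m /hg mk; rewrite linearZ /= mpolyXE_id rmorph_prod /=.
congr (_ *: _); apply: eq_bigr => i _; rewrite rmorphXn /=.
by have [->|/elem_id ->//] := eqVneq i k; rewrite mk !expr0.
Qed.

Lemma free_ofZ k c f : free_of k f -> free_of k (c *: f).
Proof. by move=> hf m /msuppZ_le; apply: hf. Qed.

Lemma elemK k a f : a != 0 -> free_of k f -> cancel (elem k a f) (elem k a^-1 (- a^-1 *: f)).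
Proof.
move=> nza hf; apply: (@endo_ext _ _ (elem k a^-1 (- a^-1 *: f) \o elem k a f) idfun) => i /=.
have [->|neq_ik] := eqVneq i k; last by rewrite !elem_id.
rewrite elemE linearD linearZ /= elemE elem_free // scalerDr !scalerA divff // scale1r.
by rewrite mulrN divff // scaleN1r subrK.
Qed.

(** The Jacobian matrix differs from the identity only in row [k], whose diagonal entry is [a]
    because [f] does not involve that variable. *)
Lemma elem_tame_auto k a f : a != 0 -> free_of k f -> tame_auto (elem k a f).
Proof.
move=> nza hf; have K1 := elemK nza hf.
have K2 : cancel (elem k a^-1 (- a^-1 *: f)) (elem k a f).
  have := elemK (invr_neq0 nza) (free_ofZ (c := - a^-1) hf).
  by rewrite invrK scalerA mulrNN divff // scale1r.
split; last by exists (elem k a^-1 (- a^-1 *: f)).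
  apply: tame_elementary; split; first by exists (elem k a^-1 (- a^-1 *: f)).
  by exists k, a, f; split=> // [|i]; [apply: elemE | apply: elem_id].
exists a => //; rewrite /jacobian (@det_row_replaced _ _ _ k) => [|i j neq_ik].
  rewrite mxE elemE mderivD mderivZ mderivXU eqxx [mderiv k f](_ : _ = 0).
    by rewrite addr0 -mul_mpolyC mulr1.
  apply/mpolyP=> m; rewrite mcoeff0 mcoeff_deriv memN_msupp_eq0 ?mul0rn //.
  by apply/negP=> /hf; rewrite mnmDE mnm1E eqxx addn1.
by rewrite mxE elem_id // mderivXU.
Qed.

Lemma free_ofC k c : free_of k (c%:MP : {mpoly K[N]}).
Proof. by move=> m; rewrite msuppC; case: ifP => //= _; rewrite inE => /eqP->; rewrite mnm0E. Qed.

Lemma ord_ge1E p : p@_0 = 0 -> ord_ge 1 p.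
Proof. by move=> p0 m; rewrite ltnS leqn0 mdeg_eq0 => /eqP ->. Qed.

(** Constant terms are removed one variable at a time. The translations act before [phi], which
    fixes constants, so each subtracts exactly the constant term found. *)
Lemma exists_centering phi : exists tau, tame_auto tau /\ centered (phi \o tau : endo K N).
Proof.
suff H k : (k <= N)%N -> exists tau, tame_auto tau /\
    forall i : 'I_N, (i < k)%N -> ord_ge 1 (phi (tau 'X_i)).
  by have [tau [ntau h]] := H N (leqnn N); exists tau; split=> // i; apply: h.
elim: k => [_|k IHk lt_kN]; first by exists (idfun : endo K N); split; [apply: tame_auto_id|].
have [tau [ntau htau]] := IHk (ltnW lt_kN).
pose o := Ordinal lt_kN; pose c := (phi (tau 'X_o))@_0.
exists (tau \o elem o 1 (- c%:MP) : endo K N); split.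
  apply/tame_auto_comp/elem_tame_auto; rewrite ?oner_eq0 // -mpolyCN; exact: free_ofC.
move=> i; rewrite ltnS leq_eqVlt => /predU1P[eq_ik|lt_ik] /=.
  have -> : i = o by apply/val_inj.
  rewrite elemE scale1r !raddfB /= !endoC; apply: ord_ge1E.
  by rewrite mcoeffB mcoeffC eqxx mulr1 subrr.
by rewrite elem_id; [apply: htau | rewrite -val_eqE /= ltn_eqF].
Qed.

Lemma centered_mcoeff0 phi p : centered phi -> (phi p)@_0 = p@_0.
Proof.
move=> cphi; have h : ord_ge 1 (p - (p@_0)%:MP).
  by apply: ord_ge1E; rewrite mcoeffB mcoeffC eqxx mulr1 subrr.
have := centered_ord_ge cphi h (m := 0%MM); rewrite mdeg0 => /(_ isT).
by rewrite rmorphB /= endoC mcoeffB mcoeffC eqxx mulr1 => /eqP; rewrite subr_eq0 => /eqP.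
Qed.

Lemma mcoeff_mderiv0 p j : (mderiv j p)@_0 = p@_U_(j).
Proof. by rewrite mcoeff_deriv add0m mnm0E. Qed.

(** The chain rule at the origin: linear parts of centered maps compose as matrices. *)
Lemma centered_mcoeff1 phi p j : centered phi ->
  (phi p)@_U_(j) = \sum_l p@_U_(l) * (phi 'X_l)@_U_(j).
Proof.
move=> cphi; rewrite -mcoeff_mderiv0 mderiv_endo raddf_sum /=.
by apply: eq_bigr => l _; rewrite rmorphM /= centered_mcoeff0 // !mcoeff_mderiv0.
Qed.

Lemma jacobian_mcoeff0 phi :
  (jacobian phi)@_0 = \det (\matrix_(i, j) (phi 'X_i)@_U_(j)).
Proof.
rewrite /jacobian -det_map_mx; congr (\det _).
by apply/matrixP=> i j; rewrite !mxE /= mcoeff_mderiv0.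
Qed.

Lemma centered_comp phi psi : centered phi -> centered psi -> centered (phi \o psi : endo K N).
Proof. by move=> cphi cpsi i; apply: (centered_ord_ge cphi (cpsi i)). Qed.

(** The linear part is invertible, its determinant being the constant term of the Jacobian. Each row
    replacement is realized by a linear elementary automorphism composed on the left. *)
Lemma exists_linear_normalization phi : centered phi -> const_jacobian phi ->
  exists eps, [/\ tame_auto eps, centered eps & unipotent (eps \o phi : endo K N)].
Proof.
move=> cphi [c nzc jphi].
pose Q (A : 'M[K]_N) := forall phi, centered phi ->
  (forall i j, (phi 'X_i)@_U_(j) = A i j) ->
  exists eps, [/\ tame_auto eps, centered eps & unipotent (eps \o phi : endo K N)].
suff QA : forall A, A \in unitmx -> Q A.
  apply: (QA (\matrix_(i, j) (phi 'X_i)@_U_(j))) => [|//|i j]; last by rewrite mxE.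
  by rewrite unitmxE -jacobian_mcoeff0 jphi mcoeffC eqxx mulr1 unitfE.
apply: unitmx_row_replaced_ind => [|A k v vk IH] {jphi}{}phi {}cphi hphi.
  exists (idfun : endo K N); split=> [||i m]; first exact: tame_auto_id.
    by move=> i; apply: ord_geX; rewrite mdeg1.
  rewrite ltnS leq_eqVlt ltnS leqn0 => /orP[/mdeg1P[j /eqP->]|] /=.
    by rewrite mcoeffB hphi mcoeffXU mxE subrr.
  rewrite mdeg_eq0 => /eqP->; rewrite mcoeffB cphi ?mdeg0 // mcoeffX mnm1_eq0 subrr //.
(* The linear part of [eps] is [row_replaced k v]. *)
pose eps := elem k (v k) (\sum_(j | j != k) v j *: 'X_j).
have ceps : centered eps.
  have hX j : ord_ge 1 ('X_j : {mpoly K[N]}) by apply: ord_geX; rewrite mdeg1.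
  move=> i; have [->|neq_ik] := eqVneq i k; last by rewrite elem_id.
  rewrite elemE; apply: ord_geD; first exact: ord_geZ.
  by apply: ord_ge_sum => j _; apply: ord_geZ.
have neps : tame_auto eps.
  apply: elem_tame_auto => // m /msupp_sum_le; rewrite /= => /flattenP[s /mapP[j]].
  rewrite mem_filter => /andP[neq_jk _] -> /msuppZ_le; rewrite msuppX inE => /eqP ->.
  by rewrite mnm1E (negPf neq_jk).
have [||eps' [neps' ceps' ueps']] := IH (eps \o phi : endo K N); first exact: centered_comp.
  move=> i j /=; rewrite centered_mcoeff1 // mxE; apply: eq_bigr => l _.
  rewrite hphi mxE; congr (_ * _); have [->|neq_lk] := eqVneq l k.
    rewrite elemE [v k *: _ + _](_ : _ = \sum_l v l *: 'X_l); last by rewrite [RHS](bigD1 k).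
    rewrite raddf_sum /= (bigD1 j) //= big1 => [|i' neq].
      by rewrite mcoeffZ mcoeffXU eqxx mulr1 addr0.
    by rewrite mcoeffZ mcoeffXU (negPf neq) mulr0.
  by rewrite elem_id // mcoeffXU.
by exists (eps' \o eps : endo K N); split; [apply: tame_auto_comp | apply: centered_comp |].
Qed.

End TameAuto.

(** * Leading terms of tame automorphisms tangent to the identity *)

Section Attained.
Variables (K : fieldType) (N : nat).
Implicit Types (f p q : {mpoly K[N]}) (m : 'X_{1..N}) (phi psi eps : endo K N).
Implicit Types (h : 'I_N -> {mpoly K[N]}).

(** The tuple [h] stands for the vector field formed by its degree [k] part; higher terms are left
    arbitrary, so homogeneity need not be tracked. *)
Definition attained k h : Prop :=
  (forall i, ord_ge k (h i)) /\
  exists2 eps, tame_auto eps & forall i, ord_ge k.+1 (eps 'X_i - 'X_i - h i).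

Variable k : nat.
Hypothesis k_gt1 : (1 < k)%N.

Lemma attained_unipotent eps h : (forall i, ord_ge k (h i)) ->
  (forall i, ord_ge k.+1 (eps 'X_i - 'X_i - h i)) -> unipotent eps.
Proof.
move=> hh heps i; rewrite -[X in ord_ge _ X](subrK (h i)).
by apply: ord_geD; [apply: ord_geW (heps i) | apply: ord_geW (hh i)]; lia.
Qed.

Lemma attained_congr h1 h2 :
  attained k h1 -> (forall i, ord_ge k.+1 (h1 i - h2 i)) -> attained k h2.
Proof.
move=> [hh1 [eps neps heps]] h12; split=> [i|].
  rewrite -(subKr (h1 i) (h2 i)); apply: ord_geB => //.
  by apply: ord_geW (h12 i).
by exists eps => // i; apply: (ord_ge_trans (heps i)).
Qed.

Lemma attained_eq h1 h2 : attained k h1 -> h1 =1 h2 -> attained k h2.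
Proof.
by move=> ah1 h12; apply: (attained_congr ah1) => i; rewrite h12 subrr; apply: ord_ge_zero.
Qed.

Lemma attained0 : attained k (fun _ => 0).
Proof.
split=> [i|]; first exact: ord_ge_zero.
exists (idfun : endo K N) => [|i]; first exact: tame_auto_id.
by rewrite subrr subr0; apply: ord_ge_zero.
Qed.

(** Composition adds leading terms: the only interaction, [eps1 (h2 i) - h2 i], has order above [k]
    since [eps1] is unipotent. This is where [k > 1] enters. *)
Lemma attainedD h1 h2 :
  attained k h1 -> attained k h2 -> attained k (fun i => h1 i + h2 i).
Proof.
move=> [hh1 [eps1 neps1 heps1]] [hh2 [eps2 neps2 heps2]].
split=> [i|]; first exact: ord_geD.
exists (eps1 \o eps2 : endo K N) => [|i]; first exact: tame_auto_comp.
have ueps1 := attained_unipotent hh1 heps1.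
have -> : (eps1 \o eps2 : endo K N) 'X_i - 'X_i - (h1 i + h2 i) =
    eps1 (eps2 'X_i - 'X_i - h2 i) + (eps1 'X_i - 'X_i - h1 i) + (eps1 (h2 i) - h2 i).
  by rewrite !rmorphB /=; ring.
apply/ord_geD/unipotent_ord_ge => //; apply: ord_geD => //.
exact: centered_ord_ge (unipotent_centered ueps1) _.
Qed.

Lemma attained_sum (I : Type) (s : seq I) (P : pred I) (F : I -> 'I_N -> {mpoly K[N]}) :
  (forall r, P r -> attained k (F r)) ->
  attained k (fun i => \sum_(r <- s | P r) F r i).
Proof.
move=> hF; elim: s => [|r s IHs].
  by apply: (attained_eq attained0) => i; rewrite big_nil.
case Pr: (P r); last by apply: (attained_eq IHs) => i; rewrite big_cons Pr.
by apply: (attained_eq (attainedD (hF r Pr) IHs)) => i; rewrite big_cons Pr.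
Qed.

Lemma attained_elem i f : free_of i f -> ord_ge k f ->
  attained k (fun l => if l == i then f else 0).
Proof.
move=> free_f hf; split=> [l|]; first by case: eqP => // _; apply: ord_ge_zero.
exists (elem i 1 f) => [|l]; first by apply: elem_tame_auto => //; apply: oner_neq0.
rewrite (_ : _ - _ = 0); first exact: ord_ge_zero.
have [->|neq_li] := eqVneq l i; first by rewrite elemE scale1r [_ + f]addrC addrK subrr.
by rewrite elem_id // subrr subr0.
Qed.

Lemma free_ofX i m : m i = 0%N -> free_of i ('X_[m] : {mpoly K[N]}).
Proof. by move=> mi m'; rewrite msuppX inE => /eqP ->. Qed.

Lemma free_ofXU i j : i != j -> free_of i ('X_j : {mpoly K[N]}).
Proof. by move=> neq_ij; apply: free_ofX; rewrite mnm1E eq_sym (negPf neq_ij). Qed.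

Lemma free_ofM i f g : free_of i f -> free_of i g -> free_of i (f * g).
Proof.
move=> hf hg m /msuppM_le /allpairsP[[m1 m2] /= [/hf m1i /hg m2i ->]].
by rewrite mnmDE m1i m2i.
Qed.

Lemma free_of_exp i f n : free_of i f -> free_of i (f ^+ n).
Proof.
move=> hf; elim: n => [|n IHn]; last by rewrite exprS; apply: free_ofM.
by rewrite expr0 -mpolyC1; apply: free_ofC.
Qed.

(** Conjugate the elementary map adding [f] to ['X_j] by the substitution of ['X_i + t *: 'X_j] for
    ['X_i]. The displacement is exactly the stated field, with no error of higher order. *)
Lemma attained_shear i j m n t c : i != j -> m i = 0%N -> m j = 0%N ->
    (mdeg m + n)%N = k ->
  let g := 'X_[m] * ('X_i + t *: 'X_j) ^+ n in
  attained k (fun l => if l == i then (t * c) *: g else if l == j then - c *: g else 0).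
Proof.
move=> neq_ij mi mj def_k g.
have neq_ji : j != i by rewrite eq_sym.
have ord_g : ord_ge k g.
  rewrite -def_k; apply: ord_geM; first exact: ord_geX.
  rewrite -[X in ord_ge X]muln1; apply/ord_ge_exp/ord_geD; last apply: ord_geZ.
    by apply: ord_geX; rewrite mdeg1.
  by apply: ord_geX; rewrite mdeg1.
split=> [l|].
  by case: eqP => _; [|case: eqP => _]; try exact: ord_geZ; apply: ord_ge_zero.
pose f := - c *: ('X_[m] * 'X_i ^+ n) : {mpoly K[N]}.
pose la (s : K) := elem i 1 (s *: 'X_j).
have nla s : tame_auto (la s).
  by apply: elem_tame_auto; [apply: oner_neq0 | apply/free_ofZ/free_ofXU].
have free_f : free_of j f.
  by apply/free_ofZ/free_ofM; [apply: free_ofX | apply/free_of_exp/free_ofXU].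
pose e := elem j 1 f.
have ne : tame_auto e by apply: elem_tame_auto => //; apply: oner_neq0.
have la_f : la t f = - c *: g.
  rewrite /f linearZ rmorphM /= rmorphXn /= [la t _]elem_free; last exact: free_ofX.
  by rewrite elemE scale1r.
exists (la t \o (e \o la (- t)) : endo K N) => [|l]; first by do 2?apply: tame_auto_comp.
rewrite (_ : _ - _ = 0); first exact: ord_ge_zero.
have [->|neq_li] /= := eqVneq l i.
  rewrite {2}/la elemE scale1r linearD linearZ /= [e 'X_i]elem_id // [e 'X_j]elemE.
  rewrite !scale1r linearD linearZ /= linearD /= la_f {1}/la elemE scale1r.
  rewrite {1}/la elem_id // scalerDr !scaleNr scalerN opprK scalerA; ring.
have [->|neq_lj] := eqVneq l j.
  rewrite {2}/la elem_id // [e _]elemE scale1r linearD /= la_f [la t _]elem_id //; ring.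
by rewrite !elem_id // subrr subr0.
Qed.

End Attained.

(** * Hamiltonian fields as combinations of shears *)

Lemma vandermonde_dual (F : fieldType) n (x : 'I_n -> F) (s : 'I_n) :
  injective x ->
  exists g : 'I_n -> F, forall r : 'I_n, \sum_t g t * x t ^+ r = (r == s)%:R.
Proof.
move=> inj_x; pose V := Vandermonde n (\row_t x t).
have uV : V \in unitmx.
  rewrite unitmxE det_Vandermonde unitfE; apply/prodf_neq0 => i _.
  apply/prodf_neq0 => j lt_ij; rewrite !mxE subr_eq0 (inj_eq inj_x).
  by rewrite -val_eqE /= gtn_eqF.
(* Column [s] of the inverse Vandermonde matrix gives weights that extract the coefficient of degree
   [s]. *)
exists (fun t => invmx V t s) => r.
have /matrixP/(_ r s) := mulmxV uV; rewrite !mxE => <-.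
by apply: eq_bigr => t _; rewrite !mxE mulrC.
Qed.

Section CharZero.
Variables (K : fieldType) (N : nat).
Hypothesis charK0 : [pchar K] =i pred0.
Implicit Types (f p q : {mpoly K[N]}) (m w : 'X_{1..N}) (phi psi eps : endo K N).
Implicit Types (h : 'I_N -> {mpoly K[N]}).

Let natK_neq0 n : (0 < n)%N -> n%:R != 0 :> K.
Proof. by move=> n_gt0; rewrite (pcharf0P _).1 // -lt0n. Qed.

Lemma exists_hamiltonian_weights n s : (s <= n)%N ->
  exists g : 'I_n.+1 -> K,
    forall r, (r <= n)%N -> \sum_t g t * t%:R ^+ r = (r == s)%:R.
Proof.
rewrite -ltnS => lt_s; have inj_nat : injective (fun t : 'I_n.+1 => t%:R : K).
  move=> t u; wlog le_tu : t u / (t <= u)%N => [hw|] eq_tu.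
    by case/orP: (leq_total t u) => /hw; [apply | move=> h; apply/esym/h].
  apply/val_inj/eqP; rewrite eqn_leq le_tu /= -subn_eq0 -leqn0 leqNgt.
  by apply/negP=> /natK_neq0; rewrite natrB // eq_tu subrr eqxx.
have [g hg] := vandermonde_dual (Ordinal lt_s) inj_nat.
by exists g => r; rewrite -ltnS => lt_r; rewrite (hg (Ordinal lt_r)).
Qed.

Variable k : nat.
Hypothesis k_gt1 : (1 < k)%N.

(** Up to the factor [c], this is the planar Hamiltonian field of ['X_[m] * 'X_i ^+ a.+1 * 'X_j ^+
    b.+1]. It is the coefficient of [t ^+ b.+1] in the shears along ['X_i + t *: 'X_j], isolated by
    weights over the values of [t]. *)
Lemma attained_hamiltonian_split (i j : 'I_N) m a b (c : K) : i != j -> m i = 0%N -> m j = 0%N ->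
    (mdeg m + (a + b).+1)%N = k ->
  attained k (fun l =>
    if l == i then (c * b.+1%:R) *: ('X_[m] * ('X_i ^+ a.+1 * 'X_j ^+ b))
    else if l == j then (- c * a.+1%:R) *: ('X_[m] * ('X_i ^+ a * 'X_j ^+ b.+1))
    else 0).
Proof.
move=> neq_ij mi mj def_k; pose n := (a + b).+1.
(* The [i] component carries an extra factor [t], so powers up to [n.+1] occur and [n.+2] values of
   [t] are used. *)
have [|g hg] := @exists_hamiltonian_weights n.+1 b.+1; first by rewrite /n; lia.
(* Normalized for the [i] component; the ratio of consecutive binomial coefficients then makes the
   [j] component right as well. *)
pose d := c * b.+1%:R / ('C(n, b))%:R.
have nzC : ('C(n, b))%:R != 0 :> K by apply: natK_neq0; rewrite bin_gt0 /n; lia.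
have dC1 : d * ('C(n, b))%:R = c * b.+1%:R by rewrite /d divfK.
have dC2 : d * ('C(n, b.+1))%:R = c * a.+1%:R.
  have e : b.+1%:R * ('C(n, b.+1))%:R = a.+1%:R * ('C(n, b))%:R :> K.
    by rewrite -!natrM mul_bin_left /n; congr (_ * _)%:R; lia.
  by transitivity (c * (b.+1%:R * ('C(n, b.+1))%:R) / ('C(n, b))%:R);
    [rewrite /d; ring | rewrite e; field].
pose P (t : 'I_n.+2) := 'X_[m] * ('X_i + t%:R *: 'X_j) ^+ n : {mpoly K[N]}.
(* Here [q] is the extra power of [t]: 1 in the [i] component, 0 in the [j] component. The surviving
   terms are [r = b] and [r = b.+1]. *)
have expand (q : nat) : (q <= 1)%N ->
    \sum_(t < n.+2) (g t * t%:R ^+ q) *: P t =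
    \sum_(r < n.+1) ((r + q == b.+1)%N%:R * ('C(n, r))%:R) *:
      ('X_[m] * ('X_i ^+ (n - r) * 'X_j ^+ r)).
  move=> le_q1.
  under eq_bigr => t _.
    rewrite /P exprDn mulr_sumr scaler_sumr.
    under eq_bigr => r _.
      rewrite exprZn -scalerAr -scaler_nat scalerA -scalerAr scalerA.
      over.
    over.
  rewrite exchange_big /=; apply: eq_bigr => r _; rewrite -scaler_suml; congr (_ *: _).
  rewrite -hg; last by have := ltn_ord r; lia.
  rewrite mulr_suml; apply: eq_bigr => t _; rewrite exprD; ring.
have := @attained_sum _ _ _ k_gt1 _ (index_enum 'I_n.+2) xpredT _
   (fun t _ => @attained_shear _ _ _ i j m n t%:R (d * g t) neq_ij mi mj def_k).
move/attained_eq; apply => l; case: eqP => [_|_].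
  transitivity (d *: \sum_(t < n.+2) (g t * t%:R ^+ 1) *: P t).
    by rewrite scaler_sumr; apply: eq_bigr => t _; rewrite scalerA expr1; congr (_ *: _); ring.
  have lt_b : (b < n.+1)%N by rewrite /n; lia.
  rewrite expand // (bigD1 (Ordinal lt_b)) //= big1 => [|r neq_r].
    by rewrite addn1 eqxx mul1r addr0 scalerA dC1 (_ : n - b = a.+1)%N // /n; lia.
  by rewrite addn1 eqSS -[b]/(val (Ordinal lt_b)) val_eqE (negPf neq_r) mul0r scale0r.
case: eqP => [_|_]; last by rewrite big1.
transitivity (- d *: \sum_(t < n.+2) (g t * t%:R ^+ 0) *: P t).
  by rewrite scaler_sumr; apply: eq_bigr => t _; rewrite scalerA expr0; congr (_ *: _); ring.
have lt_b : (b.+1 < n.+1)%N by rewrite /n; lia.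
rewrite expand // (bigD1 (Ordinal lt_b)) //= big1 => [|r neq_r].
  by rewrite addn0 eqxx mul1r addr0 scalerA mulNr dC2 mulNr (_ : n - b.+1 = a)%N // /n; lia.
by rewrite addn0 -[b.+1]/(val (Ordinal lt_b)) val_eqE (negPf neq_r) mul0r scale0r.
Qed.

(** Erasing the exponents of [w] at [i] and [j] leaves the monomial [m] required by the split
    form. *)
Lemma attained_hamiltonian (i j : 'I_N) w (c : K) : i != j -> (mdeg w).+1 = k ->
  attained k (fun l =>
    if l == i then (c * (w j).+1%:R) *: 'X_[w + U_(i)]
    else if l == j then (- c * (w i).+1%:R) *: 'X_[w + U_(j)]
    else 0).
Proof.
move=> neq_ij def_k.
pose m := [multinom if (l == i) || (l == j) then 0%N else w l | l < N].
have def_w : w = (m + (U_(i) *+ w i + U_(j) *+ w j))%MM.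
  apply/mnmP => l; rewrite !(mnmDE, mulmnE, mnm1E, mnmE).
  have [->|neq_li] := eqVneq l i.
    by rewrite /= [j == i]eq_sym (negPf neq_ij) mul1n mul0n addn0.
  have [->|neq_lj] := eqVneq l j; first by rewrite mul0n mul1n.
  by rewrite !mul0n !addn0.
have mi : m i = 0%N by rewrite mnmE eqxx.
have mj : m j = 0%N by rewrite mnmE eqxx orbT.
have Xw e1 e2 : 'X_[m] * ('X_i ^+ e1 * 'X_j ^+ e2) =
    'X_[m + (U_(i) *+ e1 + U_(j) *+ e2)] :> {mpoly K[N]}.
  by rewrite !mpolyXn -!mpolyXD.
have := @attained_hamiltonian_split i j m (w i) (w j) c neq_ij mi mj.
have -> : (mdeg m + (w i + w j).+1)%N = k.
  by rewrite -def_k [in RHS]def_w !mdegD !mdegMn !mdeg1 !mul1n addnS.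
move=> /(_ erefl)/attained_eq; apply => l; rewrite !Xw.
have [_|_] := eqVneq l i; last have [_|//] := eqVneq l j.
  congr (_ *: 'X_[_]); rewrite [in RHS]def_w mulmS; apply/mnmP=> l'; rewrite !mnmDE; lia.
congr (_ *: 'X_[_]); rewrite [in RHS]def_w mulmS; apply/mnmP=> l'; rewrite !mnmDE; lia.
Qed.

End CharZero.

(** * Divergence-free fields are attained *)

Section Divergence.
Variables (K : fieldType) (N : nat).
Hypothesis charK0 : [pchar K] =i pred0.
Implicit Types (f p q : {mpoly K[N]}) (m w : 'X_{1..N}) (phi psi eps : endo K N).
Implicit Types (h : 'I_N -> {mpoly K[N]}).

Lemma ord_geS d p :
  ord_ge d p -> (forall m, mdeg m = d -> p@_m = 0) -> ord_ge d.+1 p.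
Proof.
by move=> hp hd m; rewrite ltnS leq_eqVlt => /predU1P[/hd|/hp].
Qed.

(** The bounded multinomials only make the index set of the sum finite. *)
Definition free_part k i p : {mpoly K[N]} :=
  \sum_(m : 'X_{1..N < k.+1} | (mdeg m == k) && (m i == 0%N)) p@_m *: 'X_[m].

Lemma free_part_free k i p : free_of i (free_part k i p).
Proof.
move=> m /msupp_sum_le; rewrite /= => /flattenP[s /mapP[m']].
rewrite mem_filter => /andP[/andP[_ /eqP mi] _] -> /msuppZ_le.
by rewrite msuppX inE => /eqP ->.
Qed.

Lemma ord_ge_free_part k i p : ord_ge k (free_part k i p).
Proof.
by apply: ord_ge_sum => m /andP[/eqP dm _]; apply/ord_geZ/ord_geX; rewrite dm.
Qed.

(** A monomial of degree [k.+1] either avoids variable [i] or is that variable times a unique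
    monomial of degree [k]. *)
Lemma ord_ge_sub_parts k i p : ord_ge k.+1 p ->
  ord_ge k.+2 (p - (free_part k.+1 i p +
    \sum_(w : 'X_{1..N < k.+1} | mdeg w == k) p@_(w + U_(i)) *: 'X_[w + U_(i)])).
Proof.
move=> hp; apply: ord_geS.
  apply/(ord_geB hp)/ord_geD; first exact: ord_ge_free_part.
  by apply: ord_ge_sum => w /eqP dw; apply/ord_geZ/ord_geX; rewrite mdegD mdeg1 dw addn1.
move=> m dm; rewrite mcoeffB mcoeffD !raddf_sum /=.
under eq_bigr do rewrite mcoeffZ mcoeffX.
under [X in _ - (_ + X)]eq_bigr do rewrite mcoeffZ mcoeffX.
have [mi|mi] := eqVneq (m i) 0%N.
  have lt_m : (mdeg m < k.+2)%N by rewrite dm.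
  rewrite (bigD1 (BMultinom lt_m)) /= ?dm ?mi ?eqxx //= big1 => [|m' /andP[_]].
    rewrite mulr1 addr0 big1 ?addr0 ?subrr // => w _.
    rewrite [_ == m](_ : _ = false) ?mulr0 //; apply/negP.
    move=> /eqP/(congr1 (fun u : 'X_{1..N} => u i)).
    by rewrite mi mnmDE mnm1E eqxx addn1.
  by rewrite -val_eqE /= => /negPf ->; rewrite mulr0.
rewrite [X in _ - (X + _)]big1 => [|m' /andP[_ /eqP m'i]]; last first.
  by rewrite [_ == m](_ : _ = false) ?mulr0 //; apply/negP=> /eqP e; rewrite -e m'i in mi.
have mK : (m - U_(i) + U_(i) = m)%MM by apply: submK; rewrite lep1mP.
have dw : mdeg (m - U_(i)) = k.
  by apply/eqP; rewrite -eqSS -dm -[in X in _ == X]mK mdegD mdeg1 addn1.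
have lt_w : (mdeg (m - U_(i)) < k.+1)%N by rewrite dw.
rewrite add0r (bigD1 (BMultinom lt_w)) /= ?dw ?eqxx //= mK eqxx mulr1.
rewrite big1 ?addr0 ?subrr // => w /andP[_ neq_w].
rewrite [_ == m](_ : _ = false) ?mulr0 //; apply/negP=> /eqP e; case/eqP: neq_w.
by apply/val_inj; rewrite /= -e addmK.
Qed.

(** Free parts come from elementary maps. With a reference index [j] fixed, Hamiltonian fields in
    the planes [(i, j)] produce the remaining terms of each component [i] other than [j]; vanishing
    divergence then forces those of component [j] to match. *)
Lemma attained_divergence_free k h : (0 < k)%N ->
    (forall i, ord_ge k.+1 (h i)) -> ord_ge k.+1 (\sum_i mderiv i (h i)) ->
  attained k.+1 h.
Proof.
move=> k_gt0 hh divh; have k1_gt1 : (1 < k.+1)%N by [].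
case: (pickP 'I_N) => [j _|no_index]; last first.
  by apply: (attained_eq (attained0 K N k.+1)) => i; have := no_index i.
have natK_neq0 n : n.+1%:R != 0 :> K by rewrite (pcharf0P _).1.
pose c (w : 'X_{1..N}) i := (h i)@_(w + U_(i)) / (w j).+1%:R.
pose H (w : 'X_{1..N}) i l : {mpoly K[N]} :=
  if l == i then (c w i * (w j).+1%:R) *: 'X_[w + U_(i)]
  else if l == j then (- c w i * (w i).+1%:R) *: 'X_[w + U_(j)] else 0.
have attH : attained k.+1 (fun l =>
    \sum_(w : 'X_{1..N < k.+1} | mdeg w == k) \sum_(i | i != j) H w i l).
  apply: (attained_sum k1_gt1) => w /eqP dw; apply: (attained_sum k1_gt1) => i neq_ij.
  by apply: attained_hamiltonian => //; rewrite dw.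
have attF : attained k.+1 (fun l => \sum_i if l == i then free_part k.+1 i (h i) else 0).
  apply: (attained_sum k1_gt1) => i _; apply: attained_elem.
    exact: free_part_free.
  exact: ord_ge_free_part.
apply: (attained_congr (attainedD k1_gt1 attF attH)) => l.
rewrite -opprB; apply: ord_geN.
rewrite (bigD1 l) //= eqxx big1 => [|i neq_il]; last by rewrite eq_sym (negPf neq_il).
rewrite addr0 [X in _ - (_ + X)](eq_bigr (fun w : 'X_{1..N < k.+1} =>
  (h l)@_(w + U_(l)) *: 'X_[w + U_(l)])); first exact: ord_ge_sub_parts.
move=> w /eqP dw; have [->|neq_lj] := eqVneq l j; last first.
  rewrite (bigD1 l) //= /H eqxx big1 => [|i /andP[_ neq_il]].
    by rewrite addr0 /c divfK.
  by rewrite eq_sym (negPf neq_il) (negPf neq_lj).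
(* This is the coefficient of the divergence at [w]; it expresses the [j] term through the
   others. *)
have divw : \sum_i (h i)@_(w + U_(i)) * (w i).+1%:R = 0.
  rewrite -[RHS](divh w) ?dw // raddf_sum; apply: eq_bigr => i _.
  by rewrite /= mcoeff_deriv mulr_natr.
transitivity (\sum_(i | i != j) (- c w i * (w i).+1%:R) *: 'X_[w + U_(j)] : {mpoly K[N]}).
  by apply: eq_bigr => i neq_ij; rewrite /H eq_sym (negPf neq_ij) eqxx.
rewrite -scaler_suml; congr (_ *: _); apply: (mulIf (natK_neq0 (w j))).
move/eqP: divw; rewrite (bigD1 j) //= addr_eq0 => /eqP ->.
rewrite mulr_suml -sumrN; apply: eq_bigr => i _.
by rewrite mulrAC !mulNr /c divfK.
Qed.

(** * The Jacobian to first order, and the step from one degree to the next *)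

Lemma det_first_order k (M : 'M[{mpoly K[N]}]_N) : (0 < k)%N ->
  (forall i j, ord_ge k (M i j)) -> ord_ge k.+1 (\det (1%:M + M) - 1 - \tr M).
Proof.
move=> k_gt0 hM.
have le_k : (k.+1 <= k + k)%N by lia.
rewrite /determinant (bigD1 (1%g : 'S_N)) //= odd_perm1 expr0 mul1r.
rewrite [X in X - _ - _]addrC -addrA -addrA; apply: ord_geD.
  (* A permutation moving [i] also moves [s i], giving two distinct off-diagonal factors of order
     [k], and [k + k] is at least [k.+1]. *)
  apply: ord_ge_sum => s neq_s1; apply: ord_geMl.
  have [i neq_i] : exists i, s i != i.
    apply/existsP; apply: contraR neq_s1; rewrite negb_exists => /forallP s1.
    by apply/eqP/permP=> i; rewrite perm1; apply/eqP; rewrite -[_ == _]negbK.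
  have offdiag l : s l != l -> ord_ge k ((1%:M + M) l (s l)).
    by move=> neq; rewrite !mxE eq_sym (negPf neq) add0r.
  rewrite (bigD1 i) //= (bigD1 (s i)) //= mulrA; apply/ord_geMr/(ord_geW le_k)/ord_geM.
    exact: offdiag.
  by apply: offdiag; rewrite (inj_eq perm_inj).
(* For the identity permutation, the product of the factors [1 + M i i] is 1 plus the trace up to
   products of two entries. *)
rewrite addrA; pose rel p q := ord_ge k q /\ ord_ge k.+1 (p - 1 - q).
suff [] : rel (\prod_i (1%:M + M) i ((1%g : 'S_N) i)) (\tr M) by [].
rewrite /mxtrace; apply: (big_ind2 rel) => [|p1 q1 p2 q2|i _].
- by split; [apply: ord_ge_zero | rewrite subrr subr0; apply: ord_ge_zero].
- move=> [hq1 h1] [hq2 h2]; split; first exact: ord_geD.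
  have -> : p1 * p2 - 1 - (q1 + q2) =
      (p1 - 1 - q1) * p2 + (p2 - 1 - q2) + q1 * (p2 - 1 - q2 + q2) by ring.
  apply: ord_geD; first by apply: ord_geD => //; apply: ord_geMr.
  by apply/(ord_geW le_k)/ord_geM => //; apply: ord_geD => //; apply: ord_geW h2.
split=> //; rewrite !mxE perm1 eqxx addrAC addrK subrr; exact: ord_ge_zero.
Qed.

Lemma ord_ge_mderiv d i p : ord_ge d.+1 p -> ord_ge d (mderiv i p).
Proof.
by move=> hp m lt; rewrite mcoeff_deriv hp ?mul0rn // mdegD mdeg1 addn1.
Qed.

(** The divergence is the trace in the first-order expansion of the Jacobian. A constant has no
    coefficient in degree [k > 0], so its degree [k] part vanishes. *)
Lemma divergence_order k phi : (0 < k)%N -> agree k.+1 phi idfun ->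
  const_jacobian phi -> ord_ge k.+1 (\sum_i mderiv i (phi 'X_i - 'X_i)).
Proof.
move=> k_gt0 aphi [c _ jphi].
pose M : 'M[{mpoly K[N]}]_N := \matrix_(i, j) mderiv j (phi 'X_i - 'X_i).
have hM i j : ord_ge k (M i j) by rewrite mxE; apply/ord_ge_mderiv/aphi.
have := det_first_order k_gt0 hM.
have -> : 1%:M + M = \matrix_(i, j) mderiv j (phi 'X_i).
  apply/matrixP=> i j; rewrite !mxE mderivB mderivXU; ring.
rewrite -[\det _]/(jacobian phi) jphi.
have -> : \tr M = \sum_i mderiv i (phi 'X_i - 'X_i) by apply: eq_bigr => i _; rewrite mxE.
set div := \sum_i _ => hdet; have ord_div : ord_ge k div.
  by apply: ord_ge_sum => i _; apply/ord_ge_mderiv/aphi.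
apply: (ord_geS ord_div) => m dm; have := hdet m; rewrite dm => /(_ (leqnn _)).
rewrite !mcoeffB mcoeffC mcoeff1 [m == 0%MM](_ : _ = false).
  by rewrite mulr0 subrr add0r => /eqP; rewrite oppr_eq0 => /eqP.
by rewrite -mdeg_eq0 dm; case: (k) k_gt0.
Qed.

(** Take [eps] with leading term opposite to that of [phi]; what remains is the error of [eps] and
    the effect of [eps] on [h], both of order [k.+2]. *)
Lemma exists_degree_step k phi : (0 < k)%N -> agree k.+1 phi idfun ->
  const_jacobian phi ->
  exists eps, [/\ tame_auto eps, centered eps & agree k.+2 (eps \o phi : endo K N) idfun].
Proof.
move=> k_gt0 aphi jphi; pose h i := - (phi 'X_i - 'X_i).
have hh i : ord_ge k.+1 (h i) by apply/ord_geN/aphi.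
have [|_ [eps neps heps]] := attained_divergence_free k_gt0 hh.
  rewrite /h; under eq_bigr do rewrite mderivN.
  by rewrite sumrN; apply/ord_geN/divergence_order.
have ueps := attained_unipotent (k := k.+1) k_gt0 hh heps.
exists eps; split=> // [|i]; first exact: unipotent_centered.
have -> : (eps \o phi : endo K N) 'X_i - (idfun : endo K N) 'X_i =
    (eps 'X_i - 'X_i - h i) - (eps (h i) - h i).
  have -> : (eps \o phi : endo K N) 'X_i = eps 'X_i - eps (h i).
    by rewrite -rmorphB /h /= opprK addrC subrK.
  by rewrite /=; ring.
by apply: ord_geB => //; apply: unipotent_ord_ge.
Qed.

Lemma exists_normalization d phi : centered phi -> const_jacobian phi ->
  exists eps, [/\ tame_auto eps, centered eps & agree d.+2 (eps \o phi : endo K N) idfun].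
Proof.
move=> cphi jphi; elim: d => [|d [eps [neps ceps aeps]]].
  exact: exists_linear_normalization.
have jcomp : const_jacobian (eps \o phi : endo K N).
  by apply: const_jacobian_comp => //; case: neps.
have [eps' [neps' ceps' aeps']] := exists_degree_step (isT : (0 < d.+1)%N) aeps jcomp.
by exists (eps' \o eps : endo K N); split=> //; [apply: tame_auto_comp | apply: centered_comp].
Qed.

(** * Tame approximation to a prescribed order *)

Lemma centered_inv phi psi : centered phi -> cancel psi phi -> centered psi.
Proof.
move=> cphi psiK i; apply: ord_ge1E.
by rewrite -(centered_mcoeff0 _ cphi) psiK mcoeffX mnm1_eq0.
Qed.

(** Since [eps \o phi \o tau] is close to the identity, [phi] is close to [eps' \o tau']: evaluate
    at [tau' 'X_i] and apply [eps'], which is centered and so preserves orders. *)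
Lemma exists_tame_agree d phi : const_jacobian phi ->
  exists psi, tame psi /\ agree d psi phi.
Proof.
move=> jphi; have [tau [[ttau jtau [tau' tauK tau'K]] ctau]] := exists_centering phi.
have jcomp : const_jacobian (phi \o tau : endo K N) by apply: const_jacobian_comp.
have [eps [[teps _ [eps' epsK eps'K]] ceps aeps]] := exists_normalization d ctau jcomp.
exists (eps' \o tau' : endo K N); split.
  by apply: (tame_comp (phi := eps') (psi := tau')) => //;
     [apply: (tame_inv teps) | apply: (tame_inv ttau)].
move=> i; have := agreeP aeps (tau' 'X_i); rewrite /= tau'K => /ord_geN.
rewrite opprB => /(centered_ord_ge (centered_inv ceps eps'K)).
by rewrite rmorphB /= epsK; apply: ord_geW; lia.
Qed.

(** * From agreement to convergence in the metric *)

Lemma ord_ge_pihomog d j p : ord_ge d p -> (j < d)%N -> pihomog mdeg j p = 0.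
Proof.
move=> hp lt_jd; rewrite /pihomog big1_seq // => m /andP[/eqP dm _].
by rewrite hp ?scale0r // dm.
Qed.

Lemma tuple_ht_Some (u : 'I_N -> {mpoly K[N]}) l :
  tuple_ht u = Some l -> exists i, ht (u i) = Some l.
Proof.
rewrite /tuple_ht; move: l; apply: (big_ind (fun o : option nat =>
    forall l, o = Some l -> exists i, ht (u i) = Some l)) => //.
  move=> [x|] [y|] hx hy l //; rewrite ?oACE => -[<-]; [|exact: hx|exact: hy].
  by rewrite /minn; case: ifP => _; [apply: hx | apply: hy].
by move=> i _ l hl; exists i.
Qed.

(** A finite height [l] is at least [d], and exp(l) is at least 1 + l, which exceeds [d]; the
    reciprocal bound suits the Archimedean property. *)
Lemma agree_dist d phi psi : (0 < d)%N -> agree d phi psi ->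
  (Rabs (dist phi psi) < / INR d)%Re.
Proof.
move=> d_gt0 aphi; have INRd : (0 < INR d)%Re by apply/lt_0_INR/ltP.
rewrite /dist; case E: tuple_ht => [l|]; last first.
  by rewrite Rabs_R0; apply: Rinv_0_lt_compat.
have [i /ht_Some[/eqP nz _]] := tuple_ht_Some E.
have /leP/le_INR le_dl : (d <= l)%N.
  by rewrite leqNgt; apply/negP=> /(ord_ge_pihomog (aphi i)).
rewrite Rabs_pos_eq; last by apply/Rlt_le/exp_pos.
rewrite exp_Ropp; apply: Rinv_0_lt_contravar => //.
by have := exp_ineq1_le (INR l); lra.
Qed.

Lemma agree_converges (psi : nat -> endo K N) phi :
  (forall n, agree n.+1 (psi n) phi) -> converges psi phi.
Proof.
move=> aphi eps /archimed_cor1[n [lt_n /ltP n_gt0]]; exists n => l /leP le_nl.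
rewrite /Rdist Rminus_0_r; apply: Rlt_trans lt_n.
apply: Rlt_le_trans (agree_dist _ (aphi l)) _ => //.
apply: Rinv_le_contravar; first by apply/lt_0_INR/ltP.
by apply/le_INR/leP/leqW.
Qed.

End Divergence.

Theorem theorem1 (K : fieldType) (charK0 : [pchar K] =i pred0) (N : nat)
    (phi : {lrmorphism {mpoly K[N]} -> {mpoly K[N]}})
    (phi_aut : bijective phi) (phi_jac : jacobian phi = 1) :
  exists psi : nat -> {lrmorphism {mpoly K[N]} -> {mpoly K[N]}},
    (forall k, tame (psi k)) /\ converges psi phi.
Proof.
have jphi : const_jacobian phi.
  by exists 1; [apply: oner_neq0 | rewrite phi_jac mpolyC1].
(* The approximations exist only propositionally, one for each order; choice gathers them into a
   sequence. *)
have [psi hpsi] := functional_choice _ (fun n => exists_tame_agree charK0 n.+1 jphi).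
by exists psi; split=> [n|]; [|apply: agree_converges => n]; case: (hpsi n).
Qed.
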